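(* Let $H$ be an infinite dimensional separable complex Hilbert space and let $V=B(H)_{sa}$ as a JB-algebra. Then $\mathrm{Str}(V)=G(\Omega)\sqcup -G(\Omega)$ (disjoint union).
   Context: $V=B(H)_{sa}$ is the real Banach space of bounded self-adjoint operators on $H$ with operator norm and Jordan product $A\circ B=\frac12(AB+BA)$. $\Omega\subset V$ is the set of positive invertible operators. $GL(V)$ is the group of bounded invertible real-linear operators on $V$. $U_X(A)=XAX$. The structure group $\mathrm{Str}(V)$ is the set of $g\in GL(V)$ for which there is $g^*\in GL(V)$ with $U_{g(X)}=gU_Xg^*$ for all $X\in V$. $G(\Omega)=\{g\in GL(V):g(\Omega)=\Omega\}$ and $-G(\Omega)=\{-g:g\in G(\Omega)\}$. *)

(* Defs.v *)
From HB Require Import structures.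
From mathcomp Require Import all_boot all_order all_algebra.
From mathcomp Require Import all_classical all_reals all_analysis.
From mathcomp Require Import complex.

Set Implicit Arguments.
Unset Strict Implicit.
Unset Printing Implicit Defensive.

Import Order.TTheory GRing.Theory Num.Theory.
Import numFieldNormedType.Exports.

Local Open Scope classical_set_scope.
Local Open Scope ring_scope.

(* Linear in the first argument, conjugate linear in the second; the norm of
   [H] takes values in [R[i]], and [norm_inner] makes the form positive
   definite. *)
HB.mixin Record isHilbert (R : realType) H & CompleteNormedModule R[i] H := {
  inner : H -> H -> R[i] ;
  inner_linearl : forall (a : R[i]) (x y z : H),
    inner (a *: x + y) z = a * inner x z + inner y z ;
  inner_conj : forall x y : H, inner y x = Num.conj (inner x y) ;
  norm_inner : forall x : H, `|x| ^+ 2 = inner x x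
}.

#[short(type="hilbertType")]
HB.structure Definition Hilbert (R : realType) :=
  { H of isHilbert R H & CompleteNormedModule R[i] H }.

Definition separable (T : topologicalType) : Prop :=
  exists D : set T, countable D /\ dense D.

Definition finite_dimensional (K : nzRingType) (E : lmodType K) : Prop :=
  exists s : seq E, forall x : E,
    exists c : 'I_(size s) -> K, x = \sum_(i < size s) c i *: s`_i.

Section BoundedOperators.
Context (K : numFieldType) (E : normedModType K).

Definition bounded_linear (f : E -> E) : Prop :=
  linear f /\ exists M : K, forall x, `|f x| <= M * `|x|.

Definition GL : set (E -> E) :=
  [set f | bounded_linear f /\
    exists g : E -> E, [/\ bounded_linear g, cancel f g & cancel g f]].

Lemma bounded_linear_ge0 f : bounded_linear f ->
  exists2 M : K, 0 <= M & forall x, `|f x| <= M * `|x|.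
Proof.
move=> [_ [M hM]]; have [[x x0]|h] := pselect (exists x : E, x != 0).
  exists M => //; have := le_trans (normr_ge0 _) (hM x).
  by rewrite pmulr_lge0// normr_gt0.
exists 0 => // x; suff -> : x = 0.
  by have := hM 0; rewrite normr0 !mulr0.
by apply/eqP; apply: contrapT => /negP ?; apply: h; exists x.
Qed.

Lemma bounded_linear_comp f g :
  bounded_linear f -> bounded_linear g -> bounded_linear (f \o g).
Proof.
move=> fb gb; split=> [a u v|].
  by case: fb gb => fl _ [gl _] /=; rewrite gl fl.
have [M M0 hM] := bounded_linear_ge0 fb.
have [N N0 hN] := bounded_linear_ge0 gb.
by exists (M * N) => x /=; rewrite (le_trans (hM _))// -mulrA ler_wpM2l.
Qed.

End BoundedOperators.
Arguments GL {K} E.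

Section InnerTheory.
Context (R : realType) (H : hilbertType R).
Implicit Types (x y z : H) (a : R[i]).

Lemma innerDl x y z : inner (x + y) z = inner x z + inner y z.
Proof. by have := inner_linearl 1 x y z; rewrite scale1r mul1r. Qed.

Lemma inner0l z : inner (0 : H) z = 0.
Proof. by apply: (addrI (inner 0 z)); rewrite -innerDl !addr0. Qed.

Lemma innerZl a x z : inner (a *: x) z = a * inner x z.
Proof. by have := inner_linearl a x 0 z; rewrite inner0l !addr0. Qed.

Lemma innerNl x z : inner (- x) z = - inner x z.
Proof. by rewrite -scaleN1r innerZl mulN1r. Qed.

Lemma innerBl x y z : inner (x - y) z = inner x z - inner y z.
Proof. by rewrite innerDl innerNl. Qed.

Lemma innerDr x y z : inner z (x + y) = inner z x + inner z y.
Proof. by rewrite inner_conj innerDl rmorphD/= -!inner_conj. Qed.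

Lemma inner0r z : inner z (0 : H) = 0.
Proof. by rewrite inner_conj inner0l rmorph0. Qed.

Lemma innerZr a x z : inner z (a *: x) = Num.conj a * inner z x.
Proof. by rewrite inner_conj innerZl rmorphM/= -inner_conj. Qed.

Lemma innerBr x y z : inner z (x - y) = inner z x - inner z y.
Proof. by rewrite inner_conj innerBl rmorphB/= -!inner_conj. Qed.

End InnerTheory.

Section SelfAdjoint.
Context (R : realType) (H : hilbertType R).
Implicit Types (A B : H -> H) (x y : H).

Definition selfadjoint A : Prop :=
  forall x y, inner (A x) y = inner x (A y).

Definition sa_pred : {pred H -> H} :=
  fun A => `[< bounded_linear A /\ selfadjoint A >].

Lemma sa_predP A : reflect (bounded_linear A /\ selfadjoint A) (A \in sa_pred).
Proof. exact: asboolP. Qed.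

Lemma sa_pred_zmod_closed : zmod_closed sa_pred.
Proof.
split=> [|A B /sa_predP[Ab As] /sa_predP[Bb Bs]].
  apply/sa_predP; split; last by move=> x y; rewrite inner0l inner0r.
  split; first by move=> a u v /=; rewrite scaler0 addr0.
  by exists 0 => x; rewrite mul0r normr0.
apply/sa_predP; split; last first.
  by move=> x y /=; rewrite innerBl innerBr As Bs.
split=> [a u v|].
  case: Ab Bb => Al _ [Bl _].
  rewrite [LHS](_ : _ = A (a *: u + v) - B (a *: u + v))//.
  by rewrite Al Bl opprD addrACA -scalerBr.
have [M M0 hM] := bounded_linear_ge0 Ab.
have [N N0 hN] := bounded_linear_ge0 Bb.
exists (M + N) => x; rewrite (le_trans (ler_normB (A x) (B x)))//.
by rewrite mulrDl lerD.
Qed.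

HB.instance Definition _ :=
  GRing.isZmodClosed.Build (H -> H) sa_pred sa_pred_zmod_closed.

Record sa_op := SaOp { sa_fun :> H -> H; _ : sa_fun \in sa_pred }.

HB.instance Definition _ := [isSub for sa_fun].
HB.instance Definition _ := [Choice of sa_op by <:].
HB.instance Definition _ := [SubChoice_isSubZmodule of sa_op by <:].

Implicit Types (S T : sa_op) (r : R).

Lemma sa_bounded S : bounded_linear S.
Proof. by have /sa_predP[] := valP S. Qed.

Lemma sa_selfadjoint S : selfadjoint S.
Proof. by have /sa_predP[] := valP S. Qed.

Lemma sa_opP S T : S =1 T -> S = T.
Proof. by move=> ST; apply: val_inj; apply/funext. Qed.

(* Only real scalars preserve self-adjointness. *)
Lemma scale_subproof r S : (fun x => r%:C%C *: S x) \in sa_pred.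
Proof.
apply/sa_predP; split; last first.
  move=> x y; rewrite innerZl innerZr sa_selfadjoint; congr (_ * _).
  by rewrite [Num.conj _]conjc_real.
split=> [a u v|].
  have [Sl _] := sa_bounded S.
  by rewrite Sl scalerDr !scalerA mulrC.
have [M M0 hM] := bounded_linear_ge0 (sa_bounded S).
exists (`|r%:C%C| * M) => x.
by rewrite normrZ -mulrA ler_wpM2l.
Qed.

Definition sa_scale r S : sa_op := SaOp (scale_subproof r S).

Lemma sa_scaleA r s S : sa_scale r (sa_scale s S) = sa_scale (r * s) S.
Proof. by apply: sa_opP => x; rewrite /= scalerA rmorphM. Qed.

Lemma sa_scale1 : left_id 1 sa_scale.
Proof. by move=> S; apply: sa_opP => x; rewrite /= scale1r. Qed.

Lemma sa_scaleDr : right_distributive sa_scale +%R.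
Proof. by move=> r S T; apply: sa_opP => x; rewrite /= -scalerDr. Qed.

Lemma sa_scaleDl S : {morph sa_scale^~ S : r s / r + s}.
Proof. by move=> r s; apply: sa_opP => x; rewrite /= rmorphD scalerDl. Qed.

HB.instance Definition _ := GRing.Zmodule_isLmodule.Build R sa_op
  sa_scaleA sa_scale1 sa_scaleDr sa_scaleDl.

(* ||x|| as an element of [R] rather than of [R[i]]. *)
Definition hnorm x : R := complex.Re `|x|.

Lemma hnormE x : `|x| = (hnorm x)%:C%C.
Proof. by rewrite /hnorm RRe_real// ger0_real. Qed.

Definition opnorm S : R := sup [set hnorm (S x) | x in [set x | hnorm x <= 1]].

Lemma hnorm_ge0 x : 0 <= hnorm x.
Proof. by have := normr_ge0 x; rewrite hnormE lecR. Qed.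

Lemma hnorm0 : hnorm 0 = 0.
Proof. by rewrite /hnorm normr0. Qed.

Lemma hnorm_eq0 x : hnorm x = 0 -> x = 0.
Proof. by move=> x0; apply/normr0_eq0; rewrite hnormE x0. Qed.

Lemma hnormD x y : hnorm (x + y) <= hnorm x + hnorm y.
Proof. by rewrite -lecR rmorphD/= -!hnormE ler_normD. Qed.

Lemma hnormZ (a : R[i]) x : hnorm (a *: x) = complex.Re `|a| * hnorm x.
Proof.
have a_real : (complex.Re `|a|)%:C%C = `|a| by rewrite RRe_real// ger0_real.
by apply: (@complexI R); rewrite rmorphM/= -!hnormE normrZ a_real.
Qed.

Lemma hnormZr r x : hnorm (r%:C%C *: x) = `|r| * hnorm x.
Proof. by rewrite hnormZ normc_def /= expr0n addr0 sqrtr_sqr. Qed.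

Let ball_img S := [set hnorm (S x) | x in [set x | hnorm x <= 1]].

Lemma opnorm_has_sup S : has_sup (ball_img S).
Proof.
split; first by exists (hnorm (S 0)), 0 => //=; rewrite hnorm0.
have [M M0 hM] := bounded_linear_ge0 (sa_bounded S).
have Mr : (complex.Re M)%:C%C = M by rewrite RRe_real// ger0_real.
exists (complex.Re M) => _ [x /= x1 <-].
rewrite -lecR -hnormE Mr (le_trans (hM x))// -[leRHS]mulr1 ler_wpM2l//.
by rewrite hnormE lecR.
Qed.

Lemma opnorm_ub S x : hnorm x <= 1 -> hnorm (S x) <= opnorm S.
Proof. by move=> x1; apply: ub_le_sup; [case: (opnorm_has_sup S)|exists x]. Qed.

Lemma opnorm_le S r :
  (forall x, hnorm x <= 1 -> hnorm (S x) <= r) -> opnorm S <= r.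
Proof.
move=> h; apply: ge_sup; first by case: (opnorm_has_sup S).
by move=> _ [x /= x1 <-]; exact: h.
Qed.

Lemma opnorm_ge0 S : 0 <= opnorm S.
Proof. by rewrite (le_trans (hnorm_ge0 (S 0)))// opnorm_ub// hnorm0. Qed.

Lemma hnorm_opnorm S x : hnorm (S x) <= opnorm S * hnorm x.
Proof.
have Sz a u : S (a *: u) = a *: S u.
  have [Sl _] := sa_bounded S.
  have S0 : S 0 = 0.
    by apply: (addrI (S 0)); have := Sl 1 0 0; rewrite !scale1r !addr0.
  by have := Sl a u 0; rewrite S0 !addr0.
have [x0|x0] := eqVneq (hnorm x) 0.
  rewrite (hnorm_eq0 x0) -[0 in X in X <= _](scale0r (0 : H)) Sz scale0r.
  by rewrite hnorm0 mulr0.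
have xgt0 : 0 < hnorm x by rewrite lt_def x0 hnorm_ge0.
rewrite -ler_pdivrMr// mulrC -[(hnorm x)^-1]ger0_norm ?invr_ge0 ?hnorm_ge0//.
rewrite -hnormZr -Sz opnorm_ub// hnormZr ger0_norm ?invr_ge0 ?hnorm_ge0//.
by rewrite mulVf.
Qed.

Lemma opnormD S T : opnorm (S + T) <= opnorm S + opnorm T.
Proof.
apply: opnorm_le => x x1; rewrite (le_trans (hnormD (S x) (T x)))//.
by rewrite lerD// opnorm_ub.
Qed.

Lemma opnormZ r S : opnorm (r *: S) = `|r| * opnorm S.
Proof.
have le t T : opnorm (t *: T) <= `|t| * opnorm T.
  by apply: opnorm_le => x x1; rewrite hnormZr ler_wpM2l// opnorm_ub.
have [->|r0] := eqVneq r 0.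
  apply/eqP; rewrite eq_le le/= normr0 mul0r opnorm_ge0//.
apply/eqP; rewrite eq_le le/= -ler_pdivlMl ?normr_gt0// -normfV.
by have := le r^-1 (r *: S); rewrite scalerA mulVf// scale1r.
Qed.

Lemma opnorm_eq0 S : opnorm S = 0 -> S = 0.
Proof.
move=> S0; apply: sa_opP => x; apply: hnorm_eq0; apply/eqP.
by rewrite eq_le hnorm_ge0 andbT -(mul0r (hnorm x)) -S0 hnorm_opnorm.
Qed.

HB.instance Definition _ := Lmodule_isNormed.Build R sa_op
  opnormD opnormZ opnorm_eq0.

Lemma sa_normE S : `|S| = opnorm S.
Proof. by []. Qed.

Lemma jprod_subproof S T :
  (fun x => (2^-1 : R)%:C%C *: (S (T x) + T (S x))) \in sa_pred.
Proof.
have ST := bounded_linear_comp (sa_bounded S) (sa_bounded T).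
have TS := bounded_linear_comp (sa_bounded T) (sa_bounded S).
apply/sa_predP; split; last first.
  move=> x y; rewrite innerZl innerZr innerDl innerDr !sa_selfadjoint addrC.
  by congr (_ * _); exact/esym/conjc_real.
split=> [a u v|].
  have [/(_ a u v) /= -> _] := ST; have [/(_ a u v) /= -> _] := TS.
  by rewrite addrACA -[in LHS]scalerDr [LHS]scalerDr !scalerA [a * _]mulrC.
have [M M0 hM] := bounded_linear_ge0 ST.
have [N N0 hN] := bounded_linear_ge0 TS.
exists (`|(2^-1 : R)%:C%C| * (M + N)) => x.
rewrite normrZ -mulrA ler_wpM2l// mulrDl (le_trans (ler_normD _ _))//.
exact: lerD (hM x) (hN x).
Qed.

Definition jprod S T : sa_op := SaOp (jprod_subproof S T).

Lemma Uop_subproof S T : (S \o T \o S) \in sa_pred.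
Proof.
apply/sa_predP; split; last by move=> x y; rewrite /= !sa_selfadjoint.
have ST := bounded_linear_comp (sa_bounded S) (sa_bounded T).
exact: bounded_linear_comp ST (sa_bounded S).
Qed.

Definition Uop S T : sa_op := SaOp (Uop_subproof S T).

Lemma Uop_jprod S T :
  Uop S T = 2 *: jprod S (jprod S T) - jprod (jprod S S) T.
Proof.
apply: sa_opP => x /=.
have add (A : sa_op) u v : sa_fun A (u + v) = A u + A v.
  by have [Al _] := sa_bounded A; have := Al 1 u v; rewrite !scale1r.
have scl (A : sa_op) (a : R[i]) u : sa_fun A (a *: u) = a *: A u.
  have A0 : A 0 = 0 by apply: (addrI (A 0)); rewrite -add !addr0.
  by have [Al _] := sa_bounded A; have := Al a u 0; rewrite A0 !addr0.
set h := (2^-1 : R)%:C%C.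
have h2 : (2 : R)%:C%C * h = 1 by rewrite /h -rmorphM/= divff.
have hh : h + h = 1.
  by rewrite /h -rmorphD/=; have := splitr (1 : R); rewrite mul1r => <-.
have hv (v : H) : h *: (v + v) = v by rewrite scalerDr -scalerDl hh scale1r.
rewrite [RHS](_ : _ = (2 : R)%:C%C *: (h *: (S (h *: (S (T x) + T (S x)))
    + h *: (S (T (S x)) + T (S (S x)))))
  - h *: (h *: (S (S (T x)) + S (S (T x))) + T (h *: (S (S x) + S (S x)))))//.
rewrite scalerA h2 scale1r !hv scl add -scalerDr -scalerBr.
by rewrite -[LHS]hv opprD addrACA [S (S _) + _]addrC !addrK.
Qed.

Definition positive S : Prop := forall x, 0 <= inner (S x) x.

Definition Omega : set sa_op :=
  [set S | positive S /\ GL H S].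

Definition Str : set (sa_op -> sa_op) :=
  [set g | GL sa_op g /\ exists2 gstar : sa_op -> sa_op, GL sa_op gstar &
    forall S, Uop (g S) = g \o Uop S \o gstar].

Definition GOmega : set (sa_op -> sa_op) :=
  [set g | GL sa_op g /\ g @` Omega = Omega].

End SelfAdjoint.

Arguments sa_op {R} H.
Arguments Omega {R} H.
Arguments Str {R} H.
Arguments GOmega {R} H.

(* Main.v *)
(* A rank-one operator [v v^*] satisfies [Z Y Z = <Y v, v> Z] for [Z = v v^*].
   If [U_{gX} = g U_X g*], [S] is positive invertible and
   [Y = g*^-1 (S^-1)], then [U_{gX} Y = g (X S^-1 X)]; taking [gX] of rank one
   shows that [<Y v, v>] vanishes only at [v = 0].  As [g S = (g S) Y (g S)],
   the form of [g S] is definite, and affine interpolation between [1] and [S]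
   shows that its sign does not depend on [S].  Hence [g] or [-g] preserves
   [Omega].

   Conversely, let [g] preserve [Omega].  Rank-one positive operators are the
   minimal elements of the cone, so [g] maps [v v^*] to some [w w^*].  For [A]
   in [Omega], [v v^* <= t A] means [<A^-1 v, v> <= t], whence
   [<A^-1 v, v> = <(g A)^-1 w, w>].  With [A = 1 + t X] and [C = (g 1)^-1], the
   first two Taylor coefficients in [t] give
   [<X v, v> = <(g X) C w, C w>] and [<X^2 v, v> = <C (g X) C w, (g X) C w>],
   so [g (X^2) = (g X) C (g X)].  Linearizing,
   [g (X Y X) = (g X) C (g Y) C (g X)], that is [U_{gX} = g U_X g*] with
   [g* = g^-1 U_{g 1}]. *)

Require Import Defs.
From mathcomp Require Import all_boot all_order all_algebra.
From mathcomp Require Import all_classical all_reals all_analysis.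
From mathcomp Require Import complex ring lra.

Set Implicit Arguments.
Unset Strict Implicit.
Unset Printing Implicit Defensive.

Import Order.TTheory GRing.Theory Num.Theory.
Import numFieldNormedType.Exports.

Local Open Scope classical_set_scope.
Local Open Scope ring_scope.

(** * Bounded invertible operators *)

Section BoundedOperatorTheory.
Context (K : numFieldType) (E : normedModType K).
Implicit Types f g : E -> E.

Lemma GL_comp f g : GL E f -> GL E g -> GL E (f \o g).
Proof.
move=> [fb [f' [f'b fK f'K]]] [gb [g' [g'b gK g'K]]].
split; first exact: bounded_linear_comp.
exists (g' \o f'); split; first exact: bounded_linear_comp.
- exact: can_comp.
- exact: can_comp.
Qed.

Lemma linear_of_bounded f : bounded_linear f ->
  [/\ {morph f : x y / x + y}, forall a x, f (a *: x) = a *: f x & f 0 = 0].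
Proof.
move=> [fl _].
have fD : {morph f : x y / x + y}.
  by move=> x y; have := fl 1 x y; rewrite !scale1r.
have f0 : f 0 = 0 by apply: (addrI (f 0)); rewrite -fD !addr0.
by split=> // a x; have := fl a x 0; rewrite f0 !addr0.
Qed.

Lemma bounded_linearN f : bounded_linear f -> bounded_linear (\- f).
Proof.
move=> [fl [M fM]]; split; last by exists M => x; rewrite normrN.
by move=> a x y; rewrite /= fl opprD scalerN.
Qed.

Lemma GL_bounded f : GL E f -> bounded_linear f. Proof. by case. Qed.

Lemma GL_inj f : GL E f -> injective f.
Proof. by move=> [_ [g [_ fK _]]]; exact: can_inj fK. Qed.

Lemma GL_inverse f : GL E f -> exists g, [/\ GL E g, cancel f g & cancel g f].
Proof.
by move=> [fb [g [gb fK gK]]]; exists g; split=> //; split=> //; exists f.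
Qed.

Lemma GLN f : GL E f -> GL E (\- f).
Proof.
move=> [fb [g [gb fK gK]]]; split; first exact: bounded_linearN.
have [_ fZ _] := linear_of_bounded fb; have [_ gZ _] := linear_of_bounded gb.
exists (\- g); split=> [|x|x] /=; first exact: bounded_linearN.
- by rewrite -[- f x]scaleN1r gZ fK scaleN1r opprK.
- by rewrite -[- g x]scaleN1r fZ gK scaleN1r opprK.
Qed.

End BoundedOperatorTheory.

(** * Quadratic forms of self-adjoint operators *)

Section Operators.
Context (R : realType) (H : hilbertType R).
Implicit Types (S T X Y Z : sa_op H) (x y z v w : H) (a : R[i]) (r s t : R).

Lemma saD S : {morph S : x y / x + y}.
Proof. by move=> x y; have [/(_ 1 x y)] := sa_bounded S; rewrite !scale1r. Qed.

Lemma sa0 S : S 0 = 0.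
Proof. by apply: (addrI (S 0)); rewrite -saD !addr0. Qed.

Lemma saZ S a x : S (a *: x) = a *: S x.
Proof. by have [/(_ a x 0)] := sa_bounded S; rewrite sa0 !addr0. Qed.

Lemma saN S : {morph S : x / - x}.
Proof. by move=> x; rewrite -scaleN1r saZ scaleN1r. Qed.

Lemma saB S : {morph S : x y / x - y}.
Proof. by move=> x y; rewrite saD saN. Qed.

Lemma sa_addE S T x : (S + T) x = S x + T x. Proof. by []. Qed.
Lemma sa_oppE S x : (- S) x = - S x. Proof. by []. Qed.
Lemma sa_scaleE r S x : (r *: S) x = r%:C%C *: S x. Proof. by []. Qed.
Lemma UopE S T x : Uop S T x = S (T (S x)). Proof. by []. Qed.

Lemma hnormN x : hnorm (- x) = hnorm x.
Proof. by rewrite /hnorm normrN. Qed.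

Lemma conj_real r : Num.conj (r%:C%C : R[i]) = r%:C%C.
Proof. exact: conjc_real. Qed.

Lemma innerZlr r x y : inner (r%:C%C *: x) y = r%:C%C * inner x y.
Proof. exact: innerZl. Qed.

Lemma innerZrr r x y : inner x (r%:C%C *: y) = r%:C%C * inner x y.
Proof. by rewrite innerZr conj_real. Qed.

Lemma innerxx x : inner x x = (hnorm x ^+ 2)%:C%C.
Proof. by rewrite -norm_inner hnormE rmorphXn. Qed.

Lemma inner_eq0 x : (forall y, inner x y = 0) -> x = 0.
Proof.
move=> /(_ x); rewrite innerxx => /(@complexI R _ 0)/eqP.
by rewrite sqrf_eq0 => /eqP/hnorm_eq0.
Qed.

Definition qf S x : R := complex.Re (inner (S x) x).

Lemma inner_qf S x : inner (S x) x = (qf S x)%:C%C.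
Proof.
rewrite /qf RRe_real//; apply/CrealP.
by rewrite -inner_conj -sa_selfadjoint.
Qed.

Lemma qfD S T x : qf (S + T) x = qf S x + qf T x.
Proof. by apply: (@complexI R); rewrite rmorphD/= -!inner_qf innerDl. Qed.

Lemma qfZ r S x : qf (r *: S) x = r * qf S x.
Proof. by apply: (@complexI R); rewrite rmorphM/= -!inner_qf innerZl. Qed.

Lemma qfN S x : qf (- S) x = - qf S x.
Proof. by rewrite -scaleN1r qfZ mulN1r. Qed.

Lemma qfB S T x : qf (S - T) x = qf S x - qf T x.
Proof. by rewrite qfD qfN. Qed.

Lemma qf_scale S r x : qf S (r%:C%C *: x) = r ^+ 2 * qf S x.
Proof.
apply: (@complexI R); rewrite -inner_qf saZ innerZlr innerZrr inner_qf.
by rewrite expr2 !rmorphM/= mulrA.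
Qed.

Lemma inner_swap S x y : inner (S y) x = Num.conj (inner (S x) y).
Proof. by rewrite -inner_conj sa_selfadjoint. Qed.

Lemma qf_add S x y :
  qf S (x + y) = qf S x + qf S y + 2 * complex.Re (inner (S x) y).
Proof.
rewrite /qf saD !innerDl !innerDr (inner_swap S x y).
case: (inner (S x) y) => [c d]; rewrite !raddfD/=; ring.
Qed.

(* Polarization: the real part of [<S x, y>] is read off [qf], the imaginary
   part off the same formula for [i x]. *)
Lemma qf_inj S T : qf S =1 qf T -> S = T.
Proof.
move=> ST; apply: sa_opP => x.
have ReE y : complex.Re (inner (S x) y) = complex.Re (inner (T x) y).
  by have := ST (x + y); rewrite !qf_add !ST => /addrI/mulfI->.
apply/eqP; rewrite -subr_eq0; apply/eqP/inner_eq0 => y.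
rewrite innerBl; apply/eqP; rewrite subr_eq0 eq_complex ReE eqxx/=.
have := ReE ('i%C *: y); rewrite !innerZr.
case: (inner (S x) y) (inner (T x) y) => [c d] [c' d'] /=.
by rewrite !mul0r !sub0r mulN1r opprK => /eqP; rewrite mulN1r opprK.
Qed.

Lemma positiveP S : positive S <-> forall x, 0 <= qf S x.
Proof. by split=> Sp x; have := Sp x; rewrite inner_qf lecR. Qed.

(** Positivity is tested on [r x - c y] with [r = <S y, y>]; if [r = 0], it is tested on
    [x - s c y], where [c != 0] would make the form negative. *)
Lemma CauchySchwarz S : positive S -> forall x y,
  `|inner (S x) y| ^+ 2 <= (qf S x * qf S y)%:C%C.
Proof.
move=> Sp x y; rewrite rmorphM/= -!inner_qf normCK.
set p := inner (S x) x; set r := inner (S y) y; set c := inner (S x) y.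
have E (a b : R[i]) : inner (S (a *: x + b *: y)) (a *: x + b *: y) =
    a * Num.conj a * p + a * Num.conj b * c + b * Num.conj a * Num.conj c +
    b * Num.conj b * r.
  by rewrite saD !saZ !innerDl !innerDr !innerZl !innerZr (inner_swap S x y)
             -/p -/r -/c; ring.
have pJ : Num.conj p = p by rewrite /p inner_qf conj_real.
have rJ : Num.conj r = r by rewrite /r inner_qf conj_real.
have r0 : 0 <= r by exact: Sp.
move: r0; rewrite le_eqVlt => /predU1P[r0|r0].
  rewrite -r0 mulr0; have [->|c0] := eqVneq c 0; first by rewrite mul0r.
  have n0 : c * Num.conj c != 0 by rewrite mulf_neq0// conjC_eq0.
  (* The form at [x - s c y] is [p - 2 s |c|^2]; this [s] makes it [-1]. *)
  pose s := (p + 1) / (2 * (c * Num.conj c)).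
  have sJ : Num.conj s = s.
    rewrite /s rmorphM/= fmorphV/= rmorphD/= pJ !rmorphM/= conjCK rmorph1.
    by rewrite rmorph_nat [Num.conj c * c]mulrC.
  have := Sp (1 *: x + (- (s * c)) *: y); rewrite E -r0 mulr0 addr0 !rmorphN/=.
  rewrite rmorphM/= sJ rmorph1 (_ : _ + _ = -1) ?oppr_ge0 ?ler10//.
  rewrite /s; field; rewrite conjC_eq0 c0/=; do ?split => //.
have := Sp (r *: x + (- c) *: y); rewrite E !rmorphN/= rJ.
rewrite (_ : _ + _ = r * (p * r - c * Num.conj c)); last by ring.
by rewrite pmulr_rge0// subr_ge0.
Qed.

End Operators.

(** * Fixed points of contractions and invertibility of coercive operators *)

Section Omega.
Context (R : realType) (H : hilbertType R).
Implicit Types (S T X Y Z : sa_op H) (x y z v w : H) (r s t c q e : R).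

Lemma hnormX_geometric q D e : 0 <= q -> q < 1 -> 0 < e ->
  exists n, q ^+ n * D < e.
Proof.
move=> q0 q1 e0; have : `|q| < 1 by rewrite ger0_norm.
move=> /(@cvg_geometric R D q)/cvgrPdist_lt/(_ e e0)[n _ /(_ n (leqnn n))] /=.
rewrite sub0r normrN mulrC => h; exists n; apply: le_lt_trans h.
exact: ler_norm.
Qed.

Lemma contraction_fixpoint (F : H -> H) q : 0 <= q -> q < 1 ->
    (forall x y, hnorm (F x - F y) <= q * hnorm (x - y)) ->
  exists x, F x = x.
Proof.
move=> q0 q1 Fq; pose u n := iter n F 0.
(* [D] is the fixed point of [t -> q t + hnorm (F 0)], hence a bound for every iterate. *)
pose D := hnorm (F 0) / (1 - q).
have q1' : 0 < 1 - q by rewrite subr_gt0.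
have uD n : hnorm (u n) <= D.
  elim: n => [|n IH]; first by rewrite hnorm0 divr_ge0 ?hnorm_ge0// ltW.
  rewrite -[u _](subrK (F 0)) (le_trans (Defs.hnormD _ _))//.
  have := Fq (u n) 0; rewrite subr0 => h.
  rewrite (le_trans (lerD h (lexx _)))//.
  rewrite (le_trans (lerD (ler_wpM2l q0 IH) (lexx _)))//.
  have -> : hnorm (F 0) = (1 - q) * D by rewrite mulrC divfK// gt_eqF.
  by rewrite -mulrDl addrC subrK mul1r.
have ud n m : hnorm (u n - u (n + m)%N) <= q ^+ n * D.
  elim: n => [|n IH]; first by rewrite sub0r hnormN mul1r uD.
  by rewrite addSn (le_trans (Fq _ _))// exprS -mulrA ler_wpM2l.
have : cvg (u @ \oo).
  apply/cauchy_cvgP/cauchy_exP => e e0.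
  have eE : e = (complex.Re e)%:C%C by rewrite RRe_real// gtr0_real.
  have [n nD] : exists n, q ^+ n * D < complex.Re e.
    by apply: hnormX_geometric => //; rewrite -(ltcR 0) -eE.
  exists (u n); exists n => // m /= nm.
  rewrite -ball_normE /= hnormE eE ltcR.
  by apply: le_lt_trans nD; rewrite -(subnKC nm); exact: ud.
move=> /cvg_ex[l /cvgrPdist_lt ul]; exists l; apply/eqP; rewrite -subr_eq0.
apply/eqP/hnorm_eq0/eqP; apply: contrapT => /negP h0.
(* With [e = |F l - l|], late iterates [u n] and [F (u n)] lie within [e / 2] of [l], which forces
   [|F l - l| < e]. *)
set e := hnorm _ in h0; have e0 : 0 < e by rewrite lt_def h0 hnorm_ge0.
have e20 : 0 < (e / 2)%:C%C :> R[i] by rewrite (ltcR 0) divr_gt0.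
have [n _ hn] := ul _ e20.
have := hn n (leqnn n); have := hn n.+1 (leqnSn n).
rewrite /= !hnormE !ltcR => h1 h2; suff : e < e by rewrite ltxx.
have eE : e = hnorm ((F l - F (u n)) - (l - F (u n))).
  by rewrite opprB addrA subrK.
rewrite {1}eE (le_lt_trans (Defs.hnormD _ _))// hnormN [ltRHS]splitr.
apply: ler_ltD => //; rewrite (le_trans (Fq _ _))//.
by rewrite (le_trans _ (ltW h2))// ler_piMl ?hnorm_ge0// ltW.
Qed.

Lemma sa_id_subproof : (@idfun H) \in @sa_pred R H.
Proof.
by apply/sa_predP; split=> //; split=> //; exists 1 => x; rewrite mul1r.
Qed.

Definition sa_id : sa_op H := SaOp sa_id_subproof.

Lemma qf_id x : qf sa_id x = hnorm x ^+ 2.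
Proof. by rewrite /qf innerxx. Qed.

Lemma normr_inner x y : `|inner x y| <= (hnorm x * hnorm y)%:C%C.
Proof.
have pos : positive sa_id by apply/positiveP => z; rewrite qf_id sqr_ge0.
rewrite -(@ler_pXn2r _ 2)// ?nnegrE ?(lecR 0) ?mulr_ge0 ?hnorm_ge0//.
rewrite (le_trans (CauchySchwarz pos x y))//.
by rewrite !qf_id -exprMn -rmorphXn.
Qed.

Lemma Re_inner_le x y : complex.Re (inner x y) <= hnorm x * hnorm y.
Proof.
rewrite -lecR (le_trans _ (normr_inner x y))//.
by rewrite (le_trans _ (normc_ge_Re _))// lecR ler_norm.
Qed.

Lemma qf_opnorm S x : qf S x <= opnorm S * hnorm x ^+ 2.
Proof.
rewrite (le_trans (Re_inner_le (S x) x))// expr2 mulrA ler_wpM2r ?hnorm_ge0//.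
exact: hnorm_opnorm.
Qed.

Lemma hnorm_lower S c (Sc : forall x, c * hnorm x ^+ 2 <= qf S x) x :
  c * hnorm x <= hnorm (S x).
Proof.
have h := Sc x; have [->|x0] := eqVneq (hnorm x) 0.
  by rewrite mulr0 hnorm_ge0.
have x1 : 0 < hnorm x by rewrite lt_def x0 hnorm_ge0.
rewrite -(ler_pM2r x1) -mulrA -expr2 (le_trans h)//; exact: Re_inner_le.
Qed.

(** Coercivity gives [c |x| <= |S x|], hence injectivity and a bounded inverse. Surjectivity is a
    fixed-point problem: [S x = w] iff [x] is fixed by a damped step [x - (k / M) (S x - w)]. *)
Lemma lax_milgram S c : 0 < c -> (forall x, c * hnorm x ^+ 2 <= qf S x) ->
  GL H S.
Proof.
move=> c0 Sc; split; first exact: sa_bounded.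
have lower x := hnorm_lower Sc x.
have Sinj x y : S x = S y -> x = y.
  move=> xy; apply/eqP; rewrite -subr_eq0; apply/eqP/hnorm_eq0/eqP.
  rewrite eq_le hnorm_ge0 andbT -(ler_pM2l c0) mulr0 (le_trans (lower _))//.
  by rewrite saB xy subrr hnorm0.
have surj w : exists x, S x = w.
  pose M := opnorm S + c; have M0 : 0 < M by rewrite ltr_wpDl ?opnorm_ge0.
  pose k := c / M; have k0 : 0 < k by rewrite divr_gt0.
  have k1 : k <= 1 by rewrite ler_pdivrMr// mul1r lerDr opnorm_ge0.
  have sE : k / M != 0 by rewrite mulf_neq0// ?invr_eq0 gt_eqF.
  pose F x := x - (k / M)%:C%C *: (S x - w).
  (* For [z = x - y], [|F x - F y|^2 <= (1 - 2 k^2 + k^2) |z|^2 <= (1 - k^2 / 2)^2 |z|^2]. *)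
  have [||x y|x Fx] := @contraction_fixpoint F (1 - k ^+ 2 / 2).
  - by nra.
  - by rewrite ltrBlDr ltrDl divr_gt0 ?exprn_gt0.
  - have -> : F x - F y = (x - y) + (- (k / M))%:C%C *: S (x - y).
      rewrite /F saB rmorphN scaleNr opprD opprK addrACA; congr (_ + _).
      by rewrite addrC -opprB -scalerBr opprB addrA subrK.
    rewrite -(@ler_pXn2r _ 2)// ?nnegrE ?hnorm_ge0//; last first.
      by rewrite mulr_ge0 ?hnorm_ge0//; nra.
    set z := x - y; rewrite -[leLHS]qf_id qf_add !qf_id /= hnormZr exprMn.
    rewrite innerZrr -sa_selfadjoint inner_qf -rmorphM/= normrN.
    rewrite real_normK ?num_real//.
    have SM : hnorm (S z) <= M * hnorm z.
      rewrite (le_trans (hnorm_opnorm _ _))// ler_wpM2r ?hnorm_ge0//.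
      by rewrite lerDl ltW.
    have : (k / M) ^+ 2 * hnorm (S z) ^+ 2 <= k ^+ 2 * hnorm z ^+ 2.
      have [c0' M0'] := (ltW c0, ltW M0).
      rewrite -!exprMn ler_pXn2r// ?nnegrE ?mulr_ge0 ?invr_ge0 ?hnorm_ge0//.
      by rewrite -mulrA ler_pM2l// ler_pdivrMl.
    have : k ^+ 2 * hnorm z ^+ 2 <= k / M * qf S z.
      have -> : k ^+ 2 = k / M * c by rewrite expr2 -mulrA [M^-1 * c]mulrC.
      by rewrite -mulrA ler_pM2l// divr_gt0.
    move=> h1 h2.
    have m0 := mulr_ge0 (sqr_ge0 (k ^+ 2 / 2)) (sqr_ge0 (hnorm z)).
    rewrite [leRHS](_ : _ = hnorm z ^+ 2 - k ^+ 2 * hnorm z ^+ 2 +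
      (k ^+ 2 / 2) ^+ 2 * hnorm z ^+ 2); last by field.
    lra.
  - exists x; apply/eqP; rewrite -subr_eq0.
    move/eqP: Fx; rewrite /F -subr_eq0 addrAC subrr sub0r oppr_eq0 scaler_eq0.
    by rewrite (inj_eq (@complexI R) _ 0) (negbTE sE) subr_eq0.
have [T TS] := choice surj; exists T; split=> //.
  split=> [a x y|]; first by apply: Sinj; rewrite saD saZ !TS.
  exists c^-1%:C%C => x; rewrite !hnormE -rmorphM lecR mulrC.
  rewrite ler_pdivlMr// mulrC.
  by have := lower (T x); rewrite TS.
by move=> x; apply: Sinj; rewrite TS.
Qed.
End Omega.

(** * The cone and rank-one operators *)

Section Cone.
Context (R : realType) (H : hilbertType R).
Implicit Types (S T A B C X Y Z : sa_op H) (x y z v w : H) (r s t c q e : R).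

Lemma sa_inverse S : GL H S -> exists T, cancel S T /\ cancel T S.
Proof.
move=> [_ [T [Tb ST TS]]].
have Tsa : T \in @sa_pred R H.
  apply/sa_predP; split=> // x y.
  by rewrite -{2}[x]TS sa_selfadjoint TS.
by exists (SaOp Tsa).
Qed.

(** Cauchy-Schwarz at [x] and [S x] gives [|S x|^2 <= |S| qf S x], and the inverse [T] gives
    [|x| <= |T| |S x|]. The summand [1] in [M] keeps it positive. *)
Lemma Omega_lower S : Omega H S ->
  exists2 c, 0 < c & forall x, c * hnorm x ^+ 2 <= qf S x.
Proof.
move=> [Sp /sa_inverse[T [ST _]]].
pose M := opnorm T ^+ 2 * opnorm S + 1.
have M0 : 0 < M.
  by rewrite ltr_wpDl// mulr_ge0 ?sqr_ge0 ?opnorm_ge0.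
exists M^-1 => [|x]; first by rewrite invr_gt0.
have q0 : 0 <= qf S x by move/positiveP : Sp.
rewrite ler_pdivrMl//.
have h1 : hnorm (S x) ^+ 2 <= opnorm S * qf S x.
  have [->|Sx0] := eqVneq (hnorm (S x)) 0.
    by rewrite expr0n mulr_ge0 ?opnorm_ge0.
  have Sx1 : 0 < hnorm (S x) ^+ 2 by rewrite exprn_gt0// lt_def Sx0 hnorm_ge0.
  have := CauchySchwarz Sp x (S x).
  rewrite innerxx ger0_norm ?(lecR 0) ?sqr_ge0// -rmorphXn lecR => h.
  rewrite -(ler_pM2r Sx1) -expr2 (le_trans h)// [opnorm S * _]mulrC -mulrA.
  by rewrite ler_wpM2l// qf_opnorm.
have h2 : hnorm x ^+ 2 <= opnorm T ^+ 2 * hnorm (S x) ^+ 2.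
  rewrite -exprMn ler_pXn2r// ?nnegrE ?mulr_ge0 ?hnorm_ge0 ?opnorm_ge0//.
  by rewrite -{1}[x]ST hnorm_opnorm.
rewrite (le_trans h2)// /M mulrDl mul1r (le_trans (ler_wpM2l (sqr_ge0 _) h1))//.
by rewrite mulrA lerDl.
Qed.

(** This turns invertibility into an inequality on quadratic forms, stable under sums and small
    perturbations. *)
Lemma OmegaP S : Omega H S <->
  exists2 c, 0 < c & forall x, c * hnorm x ^+ 2 <= qf S x.
Proof.
split; first exact: Omega_lower.
move=> [c c0 Sc]; split; last exact: lax_milgram Sc.
apply/positiveP => x; apply: le_trans (Sc x).
by rewrite mulr_ge0 ?sqr_ge0 ?ltW.
Qed.

Lemma Omega_id : Omega H (sa_id H).
Proof. by apply/OmegaP; exists 1 => // x; rewrite mul1r qf_id. Qed.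

Lemma OmegaD S T : Omega H S -> positive T -> Omega H (S + T).
Proof.
move=> /OmegaP[c c0 Sc] /positiveP Tp; apply/OmegaP; exists c => // x.
by rewrite qfD ler_wpDr.
Qed.

Lemma OmegaZ r S : 0 < r -> Omega H S -> Omega H (r *: S).
Proof.
move=> r0 /OmegaP[c c0 Sc]; apply/OmegaP; exists (r * c); first exact: mulr_gt0.
by move=> x; rewrite qfZ -mulrA ler_pM2l.
Qed.

Lemma positiveZ r S : 0 <= r -> positive S -> positive (r *: S).
Proof.
move=> r0 /positiveP Sp; apply/positiveP => x.
by rewrite qfZ mulr_ge0.
Qed.

Lemma qf_opnorm_abs S x : `|qf S x| <= opnorm S * hnorm x ^+ 2.
Proof.
rewrite ler_norml qf_opnorm andbT lerNl -qfN (le_trans (qf_opnorm _ _))//.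
by rewrite -sa_normE normrN.
Qed.

(** The bound [d] is uniform in [t], as the remainder estimate of [resolvent_expansion] requires. *)
Lemma Omega_open A X : Omega H A ->
  exists e d, [/\ 0 < e, 0 < d & forall t, `|t| <= e ->
    forall x, d * hnorm x ^+ 2 <= qf (A + t *: X) x].
Proof.
move=> /OmegaP[c c0 Ac]; pose M := opnorm X + 1.
have M0 : 0 < M by rewrite ltr_wpDl ?opnorm_ge0.
exists (c / 2 / M), (c / 2); split; [by rewrite !divr_gt0|by rewrite divr_gt0|].
move=> t; rewrite ler_pdivlMr// => tM x.
rewrite qfD qfZ; have := Ac x; have := qf_opnorm_abs X x.
have h0 := sqr_ge0 (hnorm x).
move=> h1 h2.
have : `|t * qf X x| <= c / 2 * hnorm x ^+ 2.
  rewrite normrM (le_trans (ler_wpM2l (normr_ge0 t) h1))// mulrA.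
  rewrite ler_wpM2r// (le_trans _ tM)// ler_wpM2l// /M lerDl//.
rewrite ler_norml => /andP[h3 _].
have := splitr c; nra.
Qed.

Lemma positive_limit S :
  (forall e, 0 < e -> Omega H (S + e *: sa_id H)) -> positive S.
Proof.
move=> h; apply/positiveP => x; apply/ler_addgt0Pr => e e0.
have n0 : 0 < hnorm x ^+ 2 + 1 by rewrite ltr_wpDl ?sqr_ge0.
have [/positiveP/(_ x) + _] := h (e / (hnorm x ^+ 2 + 1)) (divr_gt0 e0 n0).
rewrite qfD qfZ qf_id => h1; rewrite (le_trans h1)// lerD2l.
by rewrite -mulrA ler_piMr// ?(ltW e0)// ler_pdivrMl// mulr1 lerDl.
Qed.

Lemma rank1_subproof v : (fun x => inner x v *: v) \in @sa_pred R H.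
Proof.
apply/sa_predP; split; last first.
  by move=> x y /=; rewrite innerZl innerZr -inner_conj mulrC.
split=> [a x y|]; first by rewrite inner_linearl scalerDl scalerA.
exists (hnorm v ^+ 2)%:C%C => x; rewrite normrZ !hnormE.
apply: le_trans (ler_wpM2r _ (normr_inner x v)) _.
  by rewrite (lecR 0) hnorm_ge0.
by rewrite -!rmorphM lecR -mulrA mulrC expr2.
Qed.

Definition rank1 v : sa_op H := SaOp (rank1_subproof v).

Lemma rank1E v x : rank1 v x = inner x v *: v. Proof. by []. Qed.

Lemma qf_rank1 v x : (qf (rank1 v) x)%:C%C = `|inner x v| ^+ 2.
Proof. by rewrite -inner_qf rank1E innerZl normCK -inner_conj. Qed.

Lemma rank1_positive v : positive (rank1 v).
Proof. by move=> x; rewrite inner_qf qf_rank1 exprn_ge0. Qed.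

Lemma rank1_eq0 v : rank1 v = 0 -> v = 0.
Proof.
move=> v0; apply/hnorm_eq0/eqP; rewrite -sqrf_eq0; apply/eqP/(@complexI R).
have [/eqP|->] : inner v v = 0 \/ v = 0.
- have /eqP : rank1 v v = 0 by rewrite v0.
  by rewrite rank1E scaler_eq0 => /orP[]/eqP; [left|right].
- by rewrite innerxx => /eqP.
- by rewrite Defs.hnorm0 expr0n.
Qed.

Lemma rank1Z r v : rank1 (r%:C%C *: v) = r ^+ 2 *: rank1 v.
Proof.
apply: sa_opP => x; rewrite sa_scaleE !rank1E innerZrr !scalerA.
by congr (_ *: _); rewrite expr2 rmorphM/= mulrAC.
Qed.

End Cone.

(** * The structure group *)

Section StructureGroup.
Context (R : realType) (H : hilbertType R).
Implicit Types (S T A B C X Y Z : sa_op H) (x y z v w : H) (r s t c q e : R).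
Implicit Types (g : sa_op H -> sa_op H).
Notation "1H" := (sa_id H).

Lemma Uop_bounded S : bounded_linear (Uop S).
Proof.
split=> [a T T'|].
  apply: sa_opP => x.
  by rewrite UopE !sa_addE !sa_scaleE saD saZ.
exists (opnorm S ^+ 2) => T; rewrite !sa_normE; apply: opnorm_le => x x1.
rewrite UopE (le_trans (hnorm_opnorm _ _))// expr2 -mulrA.
rewrite ler_wpM2l ?opnorm_ge0// (le_trans (hnorm_opnorm _ _))// mulrC.
by rewrite ler_wpM2r ?opnorm_ge0// opnorm_ub.
Qed.

Lemma UopN S : Uop (- S) = Uop S.
Proof.
by apply/funext => T; apply: sa_opP => x; rewrite !UopE !sa_oppE !saN opprK.
Qed.

Lemma UopK S T : cancel S T -> cancel T S -> cancel (Uop S) (Uop T).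
Proof. by move=> ST TS X; apply: sa_opP => x; rewrite !UopE TS ST. Qed.

Lemma Uop_GL S : GL H S -> GL (sa_op H) (Uop S).
Proof.
move=> /sa_inverse[T [ST TS]]; split; first exact: Uop_bounded.
by exists (Uop T); split; [exact: Uop_bounded|exact: UopK|exact: UopK].
Qed.

(** [S T S = 1] makes [S T] a left inverse and [T S] a right inverse of [S], so they coincide. *)
Lemma GL_of_Uop S T : Uop S T = 1H -> GL H S.
Proof.
move=> ST; have E x : S (T (S x)) = x by rewrite -UopE ST.
split; first exact: sa_bounded.
exists (S \o T); split=> //.
  by apply: bounded_linear_comp; exact: sa_bounded.
by move=> x /=; rewrite -{1}[x]E E E.
Qed.

Lemma Uop_rank1 v T : qf T v = 0 -> Uop (rank1 v) T = 0.
Proof.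
move=> Tv; apply: sa_opP => x; rewrite UopE !rank1E saZ innerZl inner_qf Tv.
by rewrite mulr0 scale0r.
Qed.

(** If the form is negative at [w] and positive at [v], the quadratic polynomial [qf S (v + t w)]
    has a real root. There [v + t w = 0] would give [v] the sign of [w], so a nonzero null vector
    appears. *)
Lemma definite_sign S : (forall x, x != 0 -> qf S x != 0) ->
  positive S \/ positive (- S).
Proof.
move=> Sd; have [Sp|/existsNP[w /negP]] := pselect (forall x, 0 <= qf S x).
  by left; apply/positiveP.
rewrite -ltNge => Sw; right; apply/positiveP => v; rewrite qfN oppr_ge0.
rewrite leNgt; apply/negP => Sv.
pose r := complex.Re (inner (S v) w).
pose u := Num.sqrt (r ^+ 2 - qf S v * qf S w).
have u2 : u ^+ 2 = r ^+ 2 - qf S v * qf S w.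
  by rewrite sqr_sqrtr// subr_ge0 (le_trans _ (sqr_ge0 r))// nmulr_lle0 ?ltW.
pose t := - (r + u) / qf S w.
have Sw0 : qf S w != 0 by rewrite lt_eqF.
have q0 : qf S (v + t%:C%C *: w) = 0.
  rewrite qf_add qf_scale innerZrr.
  have -> : complex.Re (t%:C%C * inner (S v) w) = t * r.
    by rewrite /r; case: (inner _ _) => a b /=; rewrite mul0r subr0.
  apply: (mulfI Sw0); rewrite mulr0 /t.
  transitivity (qf S v * qf S w + u ^+ 2 - r ^+ 2); first by field.
  by rewrite u2; ring.
have [vw|/Sd] := eqVneq (v + t%:C%C *: w) 0; last by rewrite q0 eqxx.
have : qf S v = t ^+ 2 * qf S w.
  rewrite -qf_scale; have -> : t%:C%C *: w = - v.
    by apply/eqP; rewrite -addr_eq0 addrC vw.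
  rewrite /qf saN innerNl -[- v in RHS]scaleN1r innerZr rmorphN1.
  by rewrite mulN1r opprK.
by move=> E; have := mulr_ge0_le0 (sqr_ge0 t) (ltW Sw); rewrite -E leNgt Sv.
Qed.

Lemma Str_inverse g : Str H g ->
  exists g', [/\ Str H g', cancel g g' & cancel g' g].
Proof.
move=> [/GL_inverse[g' [g'GL gK g'K]] [h /GL_inverse[h' [h'GL hK h'K]] gh]].
exists g'; split=> //; split=> //; exists h' => // S.
by apply/funext => T; have /(congr1 (@^~ (h' T))) := gh (g' S);
   rewrite g'K /= h'K => ->; rewrite gK.
Qed.

Lemma StrN g : Str H g -> Str H (\- g).
Proof.
move=> [gGL [h hGL gh]]; split; first exact: GLN.
exists (\- h); first exact: GLN.
move=> S; rewrite [LHS]UopN gh; apply/funext => T /=.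
have [_ gZ _] := linear_of_bounded (GL_bounded gGL).
have [_ UZ _] := linear_of_bounded (Uop_bounded S).
by rewrite -[- h T]scaleN1r UZ gZ scaleN1r opprK.
Qed.

(** [Uop (g S) = g \o Uop S \o h] is a composite of bijections, so it takes the value [1]. *)
Lemma Str_GL g S : Str H g -> GL H S -> GL H (g S).
Proof.
move=> [/GL_inverse[g' [_ _ g'K]] [h /GL_inverse[h' [_ _ h'K]] gh]].
move=> /sa_inverse[T [ST TS]].
apply: (@GL_of_Uop _ (h' (Uop T (g' 1H)))).
by rewrite gh /= h'K UopK.
Qed.

Lemma Str_definite g S : Str H g -> Omega H S ->
  forall x, x != 0 -> qf (g S) x != 0.
Proof.
move=> gStr SO.
have gS : injective (g S) by apply: GL_inj; apply: Str_GL => //; case: SO.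
case: (gStr) => gGL [h /GL_inverse[h' [_ _ h'K]] gh].
have [gD gZ g0] := linear_of_bounded (GL_bounded gGL).
have [g' [_ gK g'K]] := GL_inverse gGL.
have [A [SA AS]] : exists A, cancel S A /\ cancel A S.
  by case: SO => _ /sa_inverse.
have UA Z : Uop (g Z) (h' A) = g (Uop Z A) by rewrite gh /= h'K.
have Adef v : qf A v = 0 -> v = 0.
  have [c c0 Sc] := Omega_lower SO.
  have := Sc (A v); rewrite {1}/qf AS -sa_selfadjoint -[complex.Re _]/(qf A v).
  move=> + Av; rewrite Av pmulr_rle0// => Av0.
  have /hnorm_eq0 : hnorm (A v) = 0.
    by apply/eqP; rewrite -sqrf_eq0 eq_le Av0 sqr_ge0.
  by move=> /(congr1 S); rewrite AS sa0.
(* Write [rank1 v = g Z]. A null [v] gives [g (Z A Z) = 0], so [Z A Z = 0], and definiteness of [A]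
   forces [Z = 0]. *)
have Ydef v : qf (h' A) v = 0 -> v = 0.
  move=> /Uop_rank1; rewrite -{1}[rank1 v]g'K UA -g0 => /(GL_inj gGL) Z0.
  apply: rank1_eq0; rewrite -[rank1 v]g'K -[in RHS]g0; congr g.
  apply: sa_opP => x; apply: Adef.
  by rewrite /qf -sa_selfadjoint -UopE Z0 inner0l.
(* As [S A S = S], [qf (h' A) (g S x) = qf (g S) x]. *)
move=> x; apply: contra_neq => gSx; apply: gS; rewrite sa0; apply: Ydef.
have -> : qf (h' A) (g S x) = qf (Uop (g S) (h' A)) x.
  by rewrite /qf UopE [in RHS]sa_selfadjoint.
by rewrite UA -gSx; congr (qf (g _) _); apply: sa_opP => y; rewrite UopE SA.
Qed.

(** If [qf (g S) x < 0 < qf (g 1) x], some positive combination of [1] and [S], still in [Omega],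
    has an image whose form vanishes at [x], against [Str_definite]. *)
Lemma Str_Omega g S : Str H g -> positive (g 1H) -> Omega H S -> Omega H (g S).
Proof.
move=> gStr /positiveP g1 SO; split; last by apply: Str_GL => //; case: SO.
have [gD gZ g0] := linear_of_bounded (GL_bounded (proj1 gStr)).
apply/positiveP => x; rewrite leNgt; apply/negP => gSx.
have x0 : x != 0 by apply: contraTneq gSx => ->; rewrite /qf inner0r ltxx.
have g1x : 0 < qf (g 1H) x.
  by rewrite lt_def g1 andbT; apply: Str_definite => //; exact: Omega_id.
have : qf (g (- qf (g S) x *: 1H + qf (g 1H) x *: S)) x = 0.
  by rewrite gD !gZ qfD !qfZ; ring.
apply/eqP; apply: Str_definite => //; apply: OmegaD.
  by apply: OmegaZ (Omega_id H); rewrite oppr_gt0.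
by apply: positiveZ; [exact: ltW|case: SO].
Qed.

Lemma Omega_OmegaN x S : x != 0 -> Omega H S -> ~ Omega H (- S).
Proof.
move=> x0 /OmegaP[c c0 /(_ x) h] /OmegaP[d d0 /(_ x)]; rewrite qfN.
have n0 : 0 < hnorm x ^+ 2.
  rewrite exprn_gt0// lt_def hnorm_ge0 andbT; apply: contra_neq x0.
  exact: hnorm_eq0.
have := mulr_gt0 c0 n0; have := mulr_gt0 d0 n0; lra.
Qed.

Lemma Str_GOmega x g : x != 0 -> Str H g -> positive (g 1H) -> GOmega H g.
Proof.
move=> x0 gStr g1; split; first by case: gStr.
have [gD gZ _] := linear_of_bounded (GL_bounded (proj1 gStr)).
apply/seteqP; split=> [_ [S SO <-]|T TO]; first exact: Str_Omega.
have [g' [g'Str gK g'K]] := Str_inverse gStr.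
exists (g' T) => //.
have g'T : GL H (g' T) by apply: Str_GL => //; case: TO.
(* If [- g' T] were positive, [g] would send it into [Omega], yet its image is [- T]. *)
have [|g'Tn] := definite_sign (Str_definite g'Str TO); first by split.
exfalso; apply: (Omega_OmegaN x0 TO).
have -> : - T = g (- g' T) by rewrite -[- g' T]scaleN1r gZ g'K scaleN1r.
by apply: Str_Omega => //; split=> //; exact: (GLN g'T).
Qed.

End StructureGroup.

(** * Order automorphisms *)

Section OrderAutomorphisms.
Context (R : realType) (H : hilbertType R).
Implicit Types (S T A B C P X Y Z : sa_op H) (x y z v w p : H).
Implicit Types (a b r s t c q e d M : R) (g : sa_op H -> sa_op H).
Notation "1H" := (sa_id H).

Lemma GOmega_inverse g : GOmega H g ->
  exists g', [/\ GOmega H g', cancel g g' & cancel g' g].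
Proof.
move=> [/GL_inverse[g' [g'GL gK g'K]] gO]; exists g'; split=> //; split=> //.
rewrite -{1}gO; apply/seteqP; split=> [_ [_ [S SO <-] <-]|S SO].
  by rewrite gK.
by exists (g S); [exists S|rewrite gK].
Qed.

Lemma GOmega_Omega g S : GOmega H g -> Omega H S -> Omega H (g S).
Proof. by move=> [_ gO] SO; rewrite -gO; exists S. Qed.

(** Positive operators are limits of elements of [Omega]: [g S + e 1] is the image of
    [S + e (g' 1)]. *)
Lemma GOmega_positive g S : GOmega H g -> positive S -> positive (g S).
Proof.
move=> gG Sp; apply: positive_limit => e e0.
have [g' [g'G gK g'K]] := GOmega_inverse gG.
have [gD gZ _] := linear_of_bounded (GL_bounded (proj1 gG)).
have -> : g S + e *: 1H = g (e *: g' 1H + S) by rewrite gD gZ g'K addrC.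
apply: GOmega_Omega => //; apply: OmegaD => //; apply: OmegaZ => //.
by apply: GOmega_Omega => //; exact: Omega_id.
Qed.

Lemma qf_eq0 S x : positive S -> qf S x = 0 -> S x = 0.
Proof.
move=> Sp Sx; apply: inner_eq0 => y; apply/eqP; rewrite -normr_eq0 -sqrf_eq0.
have := CauchySchwarz Sp x y; rewrite Sx mul0r => h.
by rewrite eq_le h exprn_ge0.
Qed.

(** Domination by [rank1 v] makes [Y] vanish on the orthogonal complement of [v]. *)
Lemma rank1_minimal v Y : positive Y -> positive (rank1 v - Y) ->
  exists r, Y = r *: rank1 v.
Proof.
move=> Yp /positiveP vY; exists (qf Y v / hnorm v ^+ 4); apply: qf_inj => x.
(* [a v] is the projection of [x] on [v]; for [v = 0] the quotient is [0], and the identities below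
   persist. *)
pose a := inner x v / (hnorm v ^+ 2)%:C%C.
have av : inner x v = a * (hnorm v ^+ 2)%:C%C.
  have [v0|v0] := eqVneq v 0.
    by rewrite v0 inner0r Defs.hnorm0 expr0n mulr0.
  rewrite divfK// (inj_eq (@complexI R) _ 0) sqrf_eq0.
  by apply: contra_neq v0; exact: hnorm_eq0.
have /qf_eq0 : qf Y (x - a *: v) = 0.
  apply/eqP; rewrite eq_le; have /positiveP -> := Yp; rewrite andbT.
  have := vY (x - a *: v); rewrite qfB subr_ge0 => /le_trans; apply.
  rewrite -lecR qf_rank1 innerBl innerZl innerxx av subrr normr0.
  by rewrite expr0n.
move=> /(_ Yp)/eqP; rewrite saB saZ subr_eq0 => /eqP Yx.
apply: (@complexI R); rewrite -inner_qf Yx innerZl [in LHS]sa_selfadjoint Yx.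
rewrite innerZr -sa_selfadjoint inner_qf mulrA -normCK qfZ !rmorphM/= qf_rank1.
have -> : `|inner x v| ^+ 2 = `|a| ^+ 2 * (hnorm v ^+ 2)%:C%C ^+ 2.
  rewrite av normrM exprMn (@ger0_norm _ (_ ^+ 2)%:C%C)//.
  by rewrite (lecR 0) sqr_ge0.
have [v0|v0] := eqVneq v 0.
  have -> : qf Y v = 0 by rewrite v0 /qf inner0r.
  by rewrite rmorph0 !mul0r mulr0.
have n0 : (hnorm v)%:C%C != 0 :> R[i].
  rewrite (inj_eq (@complexI R) _ 0); by apply: contra_neq v0; exact: hnorm_eq0.
rewrite fmorphV/= !rmorphXn/=; field.
exact: n0.
Qed.

Lemma minimal_rank1 P : positive P ->
    (forall Y, positive Y -> positive (P - Y) -> exists r, Y = r *: P) ->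
  exists w, P = rank1 w.
Proof.
move=> Pp Pmin; have [P0|/existsNP[x /eqP Px]] := pselect (forall x, P x = 0).
  by exists 0; apply: sa_opP => x; rewrite P0 rank1E scaler0.
have q0 : 0 < qf P x.
  rewrite lt_def (positiveP _).1// andbT.
  by apply: contra_neq Px; exact: qf_eq0.
pose k := Num.sqrt (qf P x)^-1.
have k2 : k ^+ 2 = (qf P x)^-1 by rewrite sqr_sqrtr// invr_ge0 ltW.
(* Cauchy-Schwarz gives [rank1 w <= P]; the scaling [k] makes the two forms agree at [x], so the
   factor from minimality is [1]. *)
pose w := k%:C%C *: P x; exists w.
have wq y : (qf (rank1 w) y)%:C%C = (qf P x)^-1%:C%C * `|inner (P x) y| ^+ 2.
  by rewrite rank1Z qfZ rmorphM/= qf_rank1 k2 -norm_conjC -inner_conj.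
have [||r wr] := Pmin (rank1 w); first exact: rank1_positive.
  apply/positiveP => y; rewrite qfB subr_ge0 -lecR wq.
  rewrite fmorphV/= mulrC ler_pdivrMr ?ltcR//.
  by rewrite -rmorphM/= mulrC CauchySchwarz.
have /complexI : (qf (rank1 w) x)%:C%C = (qf P x)%:C%C.
  rewrite wq inner_qf ger0_norm ?(lecR 0) ?ltW// -rmorphXn -rmorphM/= expr2.
  by rewrite mulKf// gt_eqF.
rewrite wr qfZ => /eqP; rewrite -subr_eq0 -{2}[qf P x]mul1r -mulrBl mulf_eq0.
by rewrite (gt_eqF q0) orbF subr_eq0 => /eqP->; rewrite scale1r.
Qed.

Lemma GOmega_rank1 g v : GOmega H g -> exists w, g (rank1 v) = rank1 w.
Proof.
move=> gG; have [g' [g'G gK g'K]] := GOmega_inverse gG.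
have [_ gZ _] := linear_of_bounded (GL_bounded (proj1 gG)).
have [g'D g'Z _] := linear_of_bounded (GL_bounded (proj1 g'G)).
apply: minimal_rank1 => [|Y Yp vY].
  by apply: GOmega_positive => //; exact: rank1_positive.
have [|r Yr] := @rank1_minimal v (g' Y) (GOmega_positive g'G Yp).
  have := GOmega_positive g'G vY.
  by rewrite -scaleN1r g'D g'Z gK scaleN1r.
by exists r; rewrite -gZ -Yr g'K.
Qed.

(* With [A y = v], [qf A y] is [<A^-1 v, v>]: the order determines it through
   the multiples of [A] dominating [v v^*]. *)
Lemma rank1_le A y t : positive A -> 0 < t ->
  positive (t *: A - rank1 (A y)) <-> qf A y <= t.
Proof.
move=> Ap t0; split.
  move=> /positiveP/(_ y); rewrite qfB qfZ subr_ge0 -lecR qf_rank1.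
  rewrite -sa_selfadjoint inner_qf.
  have A0 := (positiveP A).1 Ap y.
  rewrite ger0_norm ?(lecR 0)// -rmorphXn lecR expr2.
  move: A0; rewrite le_eqVlt => /predU1P[<- _|A0]; first exact: ltW.
  by rewrite ler_pM2r.
move=> At; apply/positiveP => x; rewrite qfB qfZ subr_ge0 -lecR qf_rank1.
rewrite -sa_selfadjoint (le_trans (CauchySchwarz Ap x y))// lecR mulrC.
by rewrite ler_wpM2r//; exact: (positiveP A).1.
Qed.

Lemma GOmega_qf g A y z v w :
  GOmega H g -> Omega H A -> g (rank1 v) = rank1 w ->
  A y = v -> g A z = w -> qf A y = qf (g A) z.
Proof.
move=> gG AO gvw Ayv gAzw.
have [g' [g'G gK g'K]] := GOmega_inverse gG.
have [gD gZ _] := linear_of_bounded (GL_bounded (proj1 gG)).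
have gAO := GOmega_Omega gG AO.
have E t : 0 < t -> (qf A y <= t) <-> (qf (g A) z <= t).
  move=> t0; have [Ap _] := AO; have [gAp _] := gAO.
  rewrite -(rank1_le _ Ap t0) -(rank1_le _ gAp t0) Ayv gAzw -gvw.
  rewrite -gZ -[- g _]scaleN1r -gZ -gD scaleN1r.
  split; first exact: GOmega_positive.
  by move=> /(GOmega_positive g'G); rewrite gK.
have ge0 S x : Omega H S -> 0 <= qf S x by move=> [/positiveP].
(* [E] needs a positive threshold, whence the slack [e]. *)
apply/eqP; rewrite eq_le; apply/andP; split; apply/ler_addgt0Pr => e e0.
  by apply/E; rewrite ?ltr_wpDl ?ge0// lerDl ltW.
by apply/E; rewrite ?ltr_wpDl ?ge0// lerDl ltW.
Qed.

End OrderAutomorphisms.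

(** * From Taylor coefficients of the inverse to the Jordan structure *)

Section Jordan.
Context (R : realType) (H : hilbertType R).
Implicit Types (S T A B C P X Y Z : sa_op H) (x y z v w p : H).
Implicit Types (a b r s t c q e d M K : R) (g : sa_op H -> sa_op H).
Notation "1H" := (sa_id H).

(* With [u = C w] and [p = C X u], the vector [y = u - t p] solves
   [(B + t X) y = w] up to [t^2 X p]; writing the exact solution as
   [y + t^2 k], the error in the quadratic form is
   [t^4 qf (B + t X) k - t^3 qf X p]. *)
Lemma resolvent_expansion B C X w : Omega H B -> cancel C B ->
  exists e M, 0 < e /\ forall t, 0 < t <= e ->
    Omega H (B + t *: X) /\ exists2 z, (B + t *: X) z = w &
      `|qf (B + t *: X) z - (qf C w - t * qf X (C w) + t ^+ 2 * qf C (X (C w)))|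
        <= t ^+ 3 * M.
Proof.
move=> BO CB; have [e0 [d [e00 d0 Ad]]] := Omega_open X BO.
pose u := C w; pose p := C (X u); pose N := hnorm (X p) ^+ 2 / d.
have Bu : B u = w by rewrite CB.
have Bp : B p = X u by rewrite CB.
(* The cap [t <= 1] absorbs the [t^4] term into [t^3 N]. *)
exists (Num.min e0 1), (`|qf X p| + N); split.
  by rewrite lt_min e00 ltr01.
move=> t /andP[t0]; rewrite le_min => /andP[te t1].
set A := B + t *: X.
have {}Ad : forall x, d * hnorm x ^+ 2 <= qf A x.
  by apply: Ad; rewrite gtr0_norm.
have AO : Omega H A by apply/OmegaP; exists d.
split=> //; have [D [_ AD]] := sa_inverse (proj2 AO).
pose k := D (X p); have Ak : A k = X p by rewrite AD.
pose y := u - t%:C%C *: p.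
have AE x : A x = B x + t%:C%C *: X x by [].
have Ay : A y = w - (t ^+ 2)%:C%C *: X p.
  rewrite saB saZ !AE Bu Bp scalerDr opprD addrA addrK scalerA.
  by rewrite -rmorphM -expr2.
exists (y + (t ^+ 2)%:C%C *: k); first by rewrite saD saZ Ak Ay subrK.
(* [d |k| <= |A k|] and [qf A k <= |A k| |k|], where [A k = X p], give a bound independent of
   [t]. *)
have kN : 0 <= qf A k <= N.
  have h0 : 0 <= qf A k by rewrite (le_trans _ (Ad k))// mulr_ge0 ?sqr_ge0 ?ltW.
  rewrite h0/= /N ler_pdivlMr//.
  rewrite (le_trans (ler_wpM2r (ltW d0) (Re_inner_le _ _)))//.
  rewrite Ak -mulrA expr2 ler_wpM2l ?hnorm_ge0// mulrC.
  by rewrite -Ak; exact: hnorm_lower.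
have Xu_p : inner (X u) p = (qf C (X u))%:C%C.
  by rewrite -inner_qf [in RHS]sa_selfadjoint.
have wp : inner w p = (qf X u)%:C%C.
  by rewrite -Bu sa_selfadjoint Bp -sa_selfadjoint inner_qf.
have wu : inner w u = (qf C w)%:C%C by rewrite /u -sa_selfadjoint inner_qf.
have Xpu : inner (X p) u = (qf C (X u))%:C%C.
  by rewrite inner_swap Xu_p conj_real.
have qE : qf A (y + (t ^+ 2)%:C%C *: k) = qf C w - t * qf X u +
    t ^+ 2 * qf C (X u) - t ^+ 3 * qf X p + t ^+ 4 * qf A k.
  have yk : inner (A y) k = (qf C (X u) - t * qf X p)%:C%C.
    rewrite sa_selfadjoint Ak /y innerBl innerZlr -sa_selfadjoint Xu_p.
    by rewrite -(sa_selfadjoint X p p) inner_qf -rmorphM -rmorphB.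
  have qy : qf A y = qf C w - t * qf X u - t ^+ 2 * (qf C (X u) - t * qf X p).
    apply: (@complexI R); rewrite -inner_qf.
    rewrite {1}Ay innerBl {1}/y innerBr innerZrr wu wp innerZlr.
    rewrite /y innerBr innerZrr Xpu inner_qf.
    by rewrite -!(rmorphM, rmorphB, rmorphD); congr (_ %:C)%C; ring.
  rewrite qf_add qf_scale innerZrr yk qy -rmorphM /=; ring.
rewrite qE -/u.
rewrite (_ : _ - _ = t ^+ 3 * (t * qf A k - qf X p)); last by ring.
have t3 : 0 < t ^+ 3 by rewrite exprn_gt0.
rewrite normrM gtr0_norm// ler_pM2l// (le_trans (ler_normB _ _))// addrC lerD2l.
case/andP: kN => k0 kN; rewrite ger0_norm; last by rewrite mulr_ge0// ltW.
by rewrite (le_trans _ kN)// ler_piMl.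
Qed.

Lemma coef_small a e K : 0 < e ->
  (forall t, 0 < t <= e -> `|a| <= t * K) -> a = 0.
Proof.
move=> e0 h; apply/eqP; rewrite -normr_le0; apply/ler_addgt0Pr => d d0.
rewrite add0r; pose t := Num.min e (d / (`|K| + 1)).
have K0 : 0 < `|K| + 1 by rewrite ltr_wpDl.
have t0 : 0 < t by rewrite lt_min e0 divr_gt0.
have := h t; rewrite t0 ge_min lexx => /(_ isT)/le_trans; apply.
have : t * (`|K| + 1) <= d by rewrite -ler_pdivlMr// ge_min lexx orbT.
apply: le_trans; rewrite ler_pM2l// (le_trans (ler_norm K))// lerDl//.
Qed.

(** The coefficients are removed in turn: after division by the power of [t] in front, the remainder
    is [O(t)], and [coef_small] applies. *)
Lemma coef_eq a b c e K : 0 < e ->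
    (forall t, 0 < t <= e -> `|a + t * b + t ^+ 2 * c| <= t ^+ 3 * K) ->
  b = 0 /\ c = 0.
Proof.
move=> e0 h; pose e' := Num.min e 1.
have e'0 : 0 < e' by rewrite lt_min e0 ltr01.
have {}h t : 0 < t <= e' -> [/\ 0 < t, t <= 1 &
    `|a + t * b + t ^+ 2 * c| <= t ^+ 3 * K].
  rewrite le_min => /and3P[t0 te t1]; split=> //; apply: h; exact/andP.
have tri t (x y : R) : `|x + y| <= t -> `|x| <= t + `|y|.
  by move=> xy; rewrite -[x](addrK y) (le_trans (ler_normB _ _))// lerD2r.
have a0 : a = 0.
  apply: (@coef_small _ e' (`|b| + `|c| + `|K|)) => // t /h[t0 t1 /tri/tri].
  move=> /le_trans; apply; rewrite !normrM (gtr0_norm t0).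
  have := ler_norm K; have := normr_ge0 K; have := normr_ge0 c.
  have : t ^+ 2 <= t by nra.
  have : t ^+ 3 <= t by rewrite exprS; nra.
  have : 0 < t ^+ 3 by rewrite exprn_gt0.
  nra.
have b0 : b = 0.
  apply: (@coef_small _ e' (`|c| + `|K|)) => // t /h[t0 t1].
  rewrite a0 add0r => /tri; rewrite !normrM (gtr0_norm t0) => bt.
  rewrite -(ler_pM2l t0) (le_trans bt)//.
  suff : t ^+ 3 * K <= t * t * `|K| by lra.
  have -> : t ^+ 3 * K = t * t * (t * K) by ring.
  rewrite ler_pM2l ?mulr_gt0// (le_trans (ler_norm _))//.
  by rewrite normrM (gtr0_norm t0) ler_piMl.
split=> //; apply: (@coef_small _ e' `|K|) => // t /h[t0 t1].
rewrite a0 b0 mulr0 addr0 add0r normrM (gtr0_norm (exprn_gt0 2 t0)).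
rewrite (exprSr t 2).
rewrite -mulrA ler_pM2l ?exprn_gt0// => /le_trans; apply.
by rewrite ler_pM2l// ler_norm.
Qed.

Lemma GOmega_coef g C v w X : GOmega H g -> cancel C (g 1H) ->
    g (rank1 v) = rank1 w ->
  qf X v = qf (g X) (C w) /\ hnorm (X v) ^+ 2 = qf C (g X (C w)).
Proof.
move=> gG Cg gvw.
have [gD gZ _] := linear_of_bounded (GL_bounded (proj1 gG)).
have id1 : cancel 1H 1H by [].
have [e1 [M1 [e10 h1]]] := resolvent_expansion X v (Omega_id H) id1.
have [e2 [M2 [e20 h2]]] :=
  resolvent_expansion (g X) w (GOmega_Omega gG (Omega_id H)) Cg.
(* These are the coefficients of the difference between the expansions for [g (1 + t X)] and
   [1 + t X], whose exact values agree by [GOmega_qf]. *)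
have [||h h'] := @coef_eq (qf C w - qf 1H v) (qf X v - qf (g X) (C w))
  (qf C (g X (C w)) - hnorm (X v) ^+ 2) (Num.min e1 e2) (M1 + M2).
- by rewrite lt_min e10.
- move=> t; rewrite le_min => /and3P[t0 te1 te2].
  have [AO [y Ay hy]] := h1 t (introT andP (conj t0 te1)).
  have [_ [z gAz hz]] := h2 t (introT andP (conj t0 te2)).
  have gA : g (1H + t *: X) = g 1H + t *: g X by rewrite gD gZ.
  rewrite -gA in gAz hz; have E := GOmega_qf gG AO gvw Ay gAz.
  rewrite -E in hz; rewrite -[hnorm _ ^+ 2]qf_id.
  have := lerD hy hz; rewrite -mulrDr; apply: le_trans.
  rewrite [X in _ <= _ + X]distrC -[X in `|X| <= _](_ :
   (qf (1H + t *: X) y - (qf 1H v - t * qf X v + t ^+ 2 * qf 1H (X v))) +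
   ((qf C w - t * qf (g X) (C w) + t ^+ 2 * qf C (g X (C w)))
     - qf (1H + t *: X) y)
   = _); last by ring.
  by rewrite (le_trans (ler_normD _ _)).
- by split; apply/eqP; rewrite -subr_eq0 ?h// -opprB h' oppr0.
Qed.

Lemma GOmega_square g C X : GOmega H g -> cancel C (g 1H) -> cancel (g 1H) C ->
  g (Uop X 1H) = Uop (g X) C.
Proof.
move=> gG Cg gC; apply: qf_inj => y.
have [g' [g'G gK g'K]] := GOmega_inverse gG.
(* Taking [w = g 1 y] makes [C w = y] an arbitrary vector; [v] is obtained by pulling [rank1 w] back
   through [g']. *)
have [v vE] := GOmega_rank1 (g 1H y) g'G.
have gvw : g (rank1 v) = rank1 (g 1H y) by rewrite -vE g'K.
have [E _] := GOmega_coef (Uop X 1H) gG Cg gvw.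
have [_ E'] := GOmega_coef X gG Cg gvw.
rewrite !gC in E E'; rewrite -E.
have -> : qf (Uop (g X) C) y = qf C (g X y) by rewrite /qf UopE sa_selfadjoint.
by rewrite -E' -qf_id /qf UopE sa_selfadjoint.
Qed.

(** The polarization [X C Y + Y C X], written through [Uop] so that it is self-adjoint by
    construction and transported by [g] through [GOmega_square]. *)
Definition triple C X Y := Uop (X + Y) C - Uop X C - Uop Y C.

Lemma tripleE C X Y x : triple C X Y x = X (C (Y x)) + Y (C (X x)).
Proof.
rewrite /triple !sa_addE !sa_oppE !UopE !sa_addE !saD.
by rewrite -[LHS]addrA -opprD [X (C (X x)) + _]addrC addrACA addrK.
Qed.

(** Expanding the nested triple yields [X C X C Y + 2 X C Y C X + Y C X C X], and the last term
    cancels the outer summands. This is the [U] operator in the product [(X C Y + Y C X) / 2]. *)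
Lemma Uop_triple C X Y : 2 *: Uop X (Uop C Y) =
  triple C X (triple C X Y) - triple C (Uop X C) Y.
Proof.
apply: sa_opP => x; rewrite sa_addE sa_oppE !tripleE !UopE !saD.
rewrite [X (C (X _)) + _]addrC addrACA addrK sa_scaleE.
by rewrite -[2%:C%C]/((1 + 1)%:C%C) rmorphD scalerDl scale1r.
Qed.

Lemma GOmega_Str g : GOmega H g -> Str H g.
Proof.
move=> gG; have [g' [g'G gK g'K]] := GOmega_inverse gG.
have [gD gZ _] := linear_of_bounded (GL_bounded (proj1 gG)).
have gN S : g (- S) = - g S by rewrite -[- S]scaleN1r gZ scaleN1r.
have [_ g1] := GOmega_Omega gG (Omega_id H).
have [C [gC Cg]] := sa_inverse g1.
have sq X := GOmega_square X gG Cg gC.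
have gt X Y : g (triple 1H X Y) = triple C (g X) (g Y).
  by rewrite /triple !gD !gN !sq gD.
have gU X Y : g (Uop X Y) = Uop (g X) (Uop C (g Y)).
  have /(congr1 g) := Uop_triple 1H X Y.
  rewrite gZ gD gN !gt sq -Uop_triple.
  have -> : Uop 1H Y = Y by apply: sa_opP.
  move=> /(congr1 ( *:%R 2^-1)); rewrite !scalerA mulVf ?scale1r//.
split; first by case: gG.
(* In [gU] the factor [Uop C] is undone by [Uop (g 1)], since [C] inverts [g 1]. *)
exists (g' \o Uop (g 1H)); first exact: GL_comp (proj1 g'G) (Uop_GL g1).
by move=> S; apply/funext => T /=; rewrite gU g'K (UopK gC Cg).
Qed.

End Jordan.

Theorem theorem4p14 (R : realType) (H : hilbertType R)
  (Hsep : separable H) (Hinf : ~ finite_dimensional H) :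
  Str H = GOmega H `|` [set \- g | g in GOmega H] /\
  GOmega H `&` [set \- g | g in GOmega H] = set0.
Proof.
(* In the zero space [Omega] and its negative coincide; a nonzero vector separates them. *)
have [x x0] : exists x : H, x != 0.
  apply: contrapT => h; apply: Hinf; exists [::] => x.
  exists (fun=> 0); rewrite big_ord0; apply/eqP; apply: contrapT => /negP x0.
  by apply: h; exists x.
split; last first.
  rewrite -subset0 => g [gG [k kG kE]].
  have := GOmega_Omega gG (Omega_id H); rewrite -kE.
  exact: (Omega_OmegaN x0 (GOmega_Omega kG (Omega_id H))).
apply/seteqP; split=> [g gStr|g [gG|[k kG <-]]].
- have [g1|g1] := definite_sign (Str_definite gStr (Omega_id H)).
    by left; exact: (Str_GOmega x0).
  right; exists (\- g); last by apply/funext => S /=; rewrite opprK.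
  by apply: (Str_GOmega x0) => //; exact: StrN.
- exact: GOmega_Str.
- exact/StrN/GOmega_Str.
Qed.
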